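(* Let $(f,\eta,q)$ be the flux, entropy and entropy-flux, on the state space $\mathcal V\subset\mathbb R^2$, of one of the following systems $\partial_tU+\partial_xf(U)=0$, each assumed strictly hyperbolic and genuinely nonlinear (under the conditions indicated) and endowed with its natural strictly convex entropy: (1) The $p$-system: $\partial_t v-\partial_x u=0$, $\partial_t u+\partial_x p(v)=0$, with $U=(v,u)\in\mathcal V=\mathbb R^2$, $p'<0$, $p''\neq0$ everywhere, $\eta(v,u)=\frac{u^2}{2}-\int^{v}p(s)\,ds$, $q(v,u)=u\,p(v)$. (2) Isentropic Euler with a general pressure law: $\partial_t\rho+\partial_x(\rho v)=0$, $\partial_t(\rho v)+\partial_x[\rho v^2+P(\rho)]=0$, in the canonical variables $U=(\rho,m)$, $m=\rho v$, with $\rho>0$, where $P:[0,\infty)\to\mathbb R$ is smooth with $P'(\rho)>0$ and $[\rho P(\rho)]''\neq0$ for $\rho>0$, $\eta=\frac12\rho v^2+S(\rho)$, $q=\frac12\rho v^3+\rho vS'(\rho)$, where $S''(\rho)=\rho^{-1}P'(\rho)$. (3) The equations of isentropic flow of an ideal gas: the system in (2) with $P(\rho)=\kappa\rho^\gamma$, $\kappa>0$, $\gamma>1$ (the case $\gamma=2$ being the system of shallow water waves), $\eta=\frac12\rho v^2+\frac{\kappa}{\gamma-1}\rho^\gamma$, $q=\frac12\rho v^3+\frac{\kappa\gamma}{\gamma-1}\rho^\gamma v$. (4) Two coupled copies of Burgers: $\partial_tu_1+\partial_xf_1(u_1)=0$, $\partial_tu_2+\partial_xf_2(u_2)=0$,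 with $U=(u_1,u_2)\in\mathcal V=\mathbb R^2$, $f_1,f_2:\mathbb R\to\mathbb R$ smooth, the images of $f_1'$ and $f_2'$ disjoint, $f_1''\neq0$ and $f_2''\neq0$ everywhere, $\eta(u_1,u_2)=h(u_1)+g(u_2)$ with $h,g:\mathbb R\to\mathbb R$ smooth and strictly convex, and $q(u_1,u_2)=\int^{u_1}h'(s)f_1'(s)\,ds+\int^{u_2}g'(s)f_2'(s)\,ds$. Then the set $\mathcal K_{f,\eta,q}$ does not contain any $T_4$ configuration.
   Context: For a flux $f=(f_1,f_2):\mathcal V\to\mathbb R^2$ and functions $\eta,q:\mathcal V\to\mathbb R$ with $\nabla q=\nabla\eta\,Df$ (an entropy/entropy-flux pair), set $$G(U)=\begin{bmatrix}u_1&f_1(U)\\ u_2&f_2(U)\\ \eta(U)&q(U)\end{bmatrix}\in\mathbb R^{3\times2},\qquad \mathcal K_{f,\eta,q}=\{G(U):U=(u_1,u_2)\in\mathcal V\}.$$ Here $(u_1,u_2)$ are the conserved variables: $(v,u)$ in (1), $(\rho,m)$ in (2) and (3), $(u_1,u_2)$ in (4); the state space in (2) and (3) is $\{(\rho,m):\rho>0\}$ (away from vacuum). Strict hyperbolicity means that $Df(U)$ has two distinct real eigenvalues $\lambda_1(U)<\lambda_2(U)$ for every $U$; genuine nonlinearity means $r_i\cdot\nabla\lambda_i\ne0$ everywhere, where $r_i$ are the corresponding right eigenvectors. $T_4$ configuration: an ordered set of four (pairwise distinct) matrices $X_1,\dots,X_4\in\mathbb R^{3\times 2}$ without rank-one connections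 (no $X_i-X_j$ has rank one) such that there exist matrices $P,C_1,\dots,C_4\in\mathbb R^{3\times2}$ and reals $\kappa_i>1$ with $X_i=P+C_1+\cdots+C_{i-1}+\kappa_iC_i$ for $i=1,\dots,4$, $\operatorname{rank}(C_i)=1$ for all $i$, and $\sum_{i=1}^4C_i=0$. *)

(* Defs.v *)
From HB Require Import structures.
From mathcomp Require Import all_boot all_order all_algebra.
From mathcomp Require Import all_classical all_reals all_analysis.

Set Implicit Arguments.
Unset Strict Implicit.
Unset Printing Implicit Defensive.

Import Order.TTheory GRing.Theory Num.Theory.
Import numFieldNormedType.Exports.

Local Open Scope ring_scope.
Local Open Scope classical_set_scope.

Local Notation "f ^` ()" := (derive1 f) : ring_scope.
Local Notation "f ^` ( n )" := (derive1n n f) : ring_scope.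

Definition smooth (R : realType) (g : R -> R) : Prop :=
  forall (n : nat) (x : R), derivable g^`(n) x 1.

(* Smoothness up to the boundary of D, i.e. g restricted to D extends to a
   smooth function on the whole line; the values of g off D are irrelevant. *)
Definition smooth_on (R : realType) (D : set R) (g : R -> R) : Prop :=
  exists2 h : R -> R, smooth h & forall x, D x -> g x = h x.

Definition strictly_convex (R : realType) (g : R -> R) : Prop :=
  forall x y t : R, x != y -> 0 < t -> t < 1 ->
    g (t * x + (1 - t) * y) < t * g x + (1 - t) * g y.

Definition T4_configuration (R : realType) (X : 'I_4 -> 'M[R]_(3, 2)) : Prop :=
  [/\ injective X,
      forall i j, \rank (X i - X j) <> 1%N
    & exists (P : 'M[R]_(3, 2)) (C : 'I_4 -> 'M[R]_(3, 2)) (kappa : 'I_4 -> R),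
      [/\ forall i, 1 < kappa i,
          forall i, \rank (C i) = 1%N,
          \sum_(i < 4) C i = 0
        & forall i, X i = P + \sum_(j < 4 | (j < i)%N) C j + kappa i *: C i]].

Section System.
Context {R : realType}.
Implicit Types (f : R * R -> R * R) (eta q : R * R -> R) (U : R * R).

Definition Gmx f eta q U : 'M[R]_(3, 2) :=
  \matrix_(i, j) nth 0 (nth [::] [:: [:: U.1; (f U).1];
                                     [:: U.2; (f U).2];
                                     [:: eta U; q U]] i) j.

Definition Kset (V : set (R * R)) f eta q : set 'M[R]_(3, 2) :=
  [set Gmx f eta q U | U in V].

Definition p_flux (p : R -> R) : R * R -> R * R :=
  fun U => (- U.2, p U.1).

Definition away_from_vacuum : set (R * R) := [set U | 0 < U.1].

(* In the canonical variables U = (rho, m), the velocity is m / rho. *)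
Definition velocity U : R := U.2 / U.1.

Definition euler_flux (P : R -> R) : R * R -> R * R :=
  fun U => (U.2, U.1 * velocity U ^+ 2 + P U.1).

Definition burgers_flux (f1 f2 : R -> R) : R * R -> R * R :=
  fun U => (f1 U.1, f2 U.2).

(* [listed_system V f eta q]: on the state space V, the flux f, entropy eta and
   entropy flux q are those of one of the four systems.  The conditions of each
   constructor already imply strict hyperbolicity, genuine nonlinearity, strict
   convexity of eta and the compatibility relation between eta, f and q, so none
   of these is required separately.  An indefinite integral is an arbitrary
   antiderivative (A, S, Q1, Q2 below). *)
Inductive listed_system :
  set (R * R) -> (R * R -> R * R) -> (R * R -> R) -> (R * R -> R) -> Prop :=
| p_system (p A : R -> R) of
    (forall v : R, derivable p v 1) &
    (forall v : R, derivable p^`() v 1) &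
    (forall v : R, p^`() v < 0) &
    (forall v : R, p^`(2) v != 0) &
    (forall v : R, is_derive v 1 A (p v)) :
  listed_system [set: R * R] (p_flux p)
    (fun U => U.2 ^+ 2 / 2 - A U.1)
    (fun U => U.2 * p U.1)
| isentropic_euler (P S : R -> R) of
    smooth_on [set rho | 0 <= rho] P &
    (forall rho : R, 0 < rho -> 0 < P^`() rho) &
    (forall rho : R, 0 < rho -> (fun r => r * P r)^`(2) rho != 0) &
    (forall rho : R, 0 < rho -> derivable S rho 1) &
    (forall rho : R, 0 < rho -> is_derive rho 1 S^`() (rho^-1 * P^`() rho)) :
  listed_system away_from_vacuum (euler_flux P)
    (fun U => U.1 * velocity U ^+ 2 / 2 + S U.1)
    (fun U => U.1 * velocity U ^+ 3 / 2 + U.1 * velocity U * S^`() U.1)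
| ideal_gas (kappa gamma : R) of
    0 < kappa & 1 < gamma :
  listed_system away_from_vacuum (euler_flux (fun rho => kappa * rho `^ gamma))
    (fun U => U.1 * velocity U ^+ 2 / 2
              + kappa / (gamma - 1) * U.1 `^ gamma)
    (fun U => U.1 * velocity U ^+ 3 / 2
              + kappa * gamma / (gamma - 1) * U.1 `^ gamma * velocity U)
| coupled_burgers (f1 f2 h g Q1 Q2 : R -> R) of
    smooth f1 & smooth f2 &
    range f1^`() `&` range f2^`() = set0 &
    (forall x : R, f1^`(2) x != 0) &
    (forall x : R, f2^`(2) x != 0) &
    smooth h & smooth g & strictly_convex h & strictly_convex g &
    (forall x : R, is_derive x 1 Q1 (h^`() x * f1^`() x)) &
    (forall x : R, is_derive x 1 Q2 (g^`() x * f2^`() x)) :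
  listed_system [set: R * R] (burgers_flux f1 f2)
    (fun U => h U.1 + g U.2)
    (fun U => Q1 U.1 + Q2 U.2).

End System.

(* Main.v *)
Require Import Defs.
From mathcomp Require Import all_boot all_order all_algebra.
From mathcomp Require Import all_classical all_reals all_analysis.
From mathcomp Require Import ring lra zify.

(** All four cases exploit one consequence of a T4 configuration.  Let m be a
    2 x 2 minor, chosen by two of the three rows.  It is a quadratic form that
    vanishes on rank-one matrices, so it is affine along the edges of the loop
    P, P + C_1, P + C_1 + C_2, and so on.  Going once around the loop, starting
    and ending on the rank-one line through X_i (where Y |-> m(Y - X_i)
    vanishes), gives positive weights l_ij, the same for the three minors, with
    sum_j l_ij m(X_j - X_i) = 0 for every i ([T4_minor_weights]).

    Coupled Burgers equations.  After subtracting the linear part at U_i of the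
    entropy, the minor of rows 1 and 3 is a Chebyshev gap in u_1
    ([chebyshev_gap]) plus a term whose sign is that of the increment of u_1 up
    to a fixed sign ([transverse_gap], where the wave speeds do not overlap).
    At a state with extremal u_1 all summands therefore have one sign, so all
    u_1 agree; then the minor of rows 2 and 3 is a Chebyshev gap in u_2, which
    forces the states to coincide.

    p-system.  Between two states with jumps dv, du, dp the minor of rows 1 and
    2 is d = du^2 + dv dp, and the minor of rows 2 and 3 is, modulo the first
    one, dp (d/2 - e) where e is the error of the trapezoidal rule for the
    integral of p.  By genuine nonlinearity e dv has a fixed sign (say
    positive), while dp dv < 0.  So for every i the weights l_ij d_ij have sum
    zero and give the pressure a negative mean: around every state there are a
    j with d_ij > 0 and a k with d_ik < 0 such that v_k < v_j.  On the other
    hand, the relation d <= 0 is transitive along increasing v, by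
    Cauchy-Schwarz ([timelike_trans]).  For four points ordered by v these two
    facts are incompatible ([no_four_point_pattern]).

    Isentropic Euler equations.  In Lagrangian variables (specific volume
    tau = 1/rho and velocity) the flow is a p-system with pressure
    p(tau) = P(1/tau), and p'' has the sign of (rho P)''.  At a fixed state
    U_i the minors of the Eulerian matrix are, up to invertible combinations
    that depend on i alone, rho_j times the Lagrangian ones; the factor rho_j
    is positive and is absorbed in the weights.  So the argument for the
    p-system, isolated in [no_T4_lagrangian], applies verbatim. *)

Set Implicit Arguments.
Unset Strict Implicit.
Unset Printing Implicit Defensive.

Import Order.TTheory GRing.Theory Num.Theory.
Import numFieldNormedType.Exports.

Local Open Scope ring_scope.
Local Open Scope classical_set_scope.

Local Notation "f ^` ()" := (derive1 f) : ring_scope.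
Local Notation "f ^` ( n )" := (derive1n n f) : ring_scope.

(** * Minors along the loop of a T4 configuration *)

Definition minor (R : realType) (r s : 'I_3) (X : 'M[R]_(3, 2)) : R :=
  X r 0 * X s 1 - X r 1 * X s 0.

Lemma rank1_outer (R : realType) (C : 'M[R]_(3, 2)) :
  \rank C = 1%N -> exists (u : 'cV[R]_3) (v : 'rV[R]_2), C = u *m v.
Proof.
move: (col_base C) (row_base C) (mulmx_base C) => u v uv rC.
by rewrite rC in u v uv; exists u, v.
Qed.

Lemma minor_rank1 (R : realType) (r s : 'I_3) (C : 'M[R]_(3, 2)) :
  \rank C = 1%N -> minor r s C = 0.
Proof.
move=> /rank1_outer[u [v ->]]; rewrite /minor !mxE !big_ord1; ring.
Qed.

Lemma minor_scale (R : realType) (r s : 'I_3) (t : R) (C : 'M[R]_(3, 2)) :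
  minor r s (t *: C) = t ^+ 2 * minor r s C.
Proof. by rewrite /minor !mxE; ring. Qed.

(** A minor vanishing on C is affine on the lines of direction C, and Y + C is
    a barycentre of Y and Y + k C; the weights are scaled by k. *)
Lemma minor_step (R : realType) (r s : 'I_3) (k : R) (Y C : 'M[R]_(3, 2)) :
  minor r s C = 0 ->
  k * minor r s (Y + C) = (k - 1) * minor r s Y + minor r s (Y + k *: C).
Proof.
move=> C0; apply/eqP; rewrite -subr_eq0.
suff -> : k * minor r s (Y + C)
    - ((k - 1) * minor r s Y + minor r s (Y + k *: C))
    = (k - k ^+ 2) * minor r s C by rewrite C0 mulr0.
by rewrite /minor !mxE; ring.
Qed.

(** The minor of Y - X0 vanishes at Y = P + C0 and at Y = P, which both lie on
    the rank-one line through X0.  The affine steps along C1, C2 and C3 lead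
    from the former to the latter, and each one brings in one more matrix. *)
Lemma T4_loop (R : realType) (P C0 C1 C2 C3 X0 X1 X2 X3 : 'M[R]_(3, 2))
    (k0 k1 k2 k3 : R) :
  1 < k1 -> 1 < k2 -> 1 < k3 ->
  \rank C0 = 1%N -> \rank C1 = 1%N -> \rank C2 = 1%N -> \rank C3 = 1%N ->
  C0 + C1 + C2 + C3 = 0 ->
  X0 = P + k0 *: C0 -> X1 = P + C0 + k1 *: C1 ->
  X2 = P + C0 + C1 + k2 *: C2 -> X3 = P + C0 + C1 + C2 + k3 *: C3 ->
  exists l1 l2 l3 : R, [/\ 0 < l1, 0 < l2, 0 < l3 & forall r s,
    l1 * minor r s (X1 - X0) + l2 * minor r s (X2 - X0)
    + l3 * minor r s (X3 - X0) = 0].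
Proof.
move=> k1_gt1 k2_gt1 k3_gt1 rC0 rC1 rC2 rC3 sumC eX0 eX1 eX2 eX3.
(* The barycentric weights of the three steps, cleared of denominators. *)
exists ((k3 - 1) * (k2 - 1)), ((k3 - 1) * k1), (k1 * k2).
split; [nra|nra|nra|move=> r s].
have st1 := minor_step k1 (P + C0 - X0) (minor_rank1 r s rC1).
have st2 := minor_step k2 (P + C0 + C1 - X0) (minor_rank1 r s rC2).
have st3 := minor_step k3 (P + C0 + C1 + C2 - X0) (minor_rank1 r s rC3).
have start : minor r s (P + C0 - X0) = 0.
  have -> : P + C0 - X0 = (1 - k0) *: C0.
    by rewrite eX0 scalerBl scale1r opprD addrACA subrr add0r.
  by rewrite minor_scale minor_rank1 ?mulr0.
have stop : minor r s (P + C0 + C1 + C2 - X0 + C3) = 0.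
  have -> : P + C0 + C1 + C2 - X0 + C3 = (- k0) *: C0.
    rewrite addrAC eX0 -!(addrA P) sumC add0r.
    by rewrite opprD addrA subrr add0r scaleNr.
  by rewrite minor_scale minor_rank1 ?mulr0.
have shift Y Z : Y + Z - X0 = Y - X0 + Z by rewrite addrAC.
rewrite start -(shift (P + C0)) -shift -eX1 in st1.
rewrite -(shift (P + C0 + C1)) -shift -eX2 in st2.
rewrite stop -shift -eX3 in st3.
move: st1 st2 st3.
move: (minor r s (X1 - X0)) (minor r s (X2 - X0)) (minor r s (X3 - X0)).
move: (minor r s (P + C0 + C1 - X0)) (minor r s (P + C0 + C1 + C2 - X0)).
move=> d2 d3 m1 m2 m3 st1 st2 st3.
have -> : m1 = k1 * d2 by rewrite st1; ring.
have -> : m2 = k2 * d3 - (k2 - 1) * d2 by rewrite st2; ring.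
have -> : m3 = - (k3 - 1) * d3.
  by apply/eqP; rewrite -subr_eq0 mulNr opprK addrC -st3 mulr0.
ring.
Qed.

(** The loop has no distinguished starting point because the C_i sum to zero,
    so [T4_loop] applies to its four rotations.  The weight of X_i itself is
    arbitrary, as its minor is zero. *)
Lemma T4_minor_weights (R : realType) (X : 'I_4 -> 'M[R]_(3, 2)) :
  T4_configuration X -> forall i, exists l : 'I_4 -> R,
    (forall j, 0 < l j) /\
    forall r s, \sum_j l j * minor r s (X j - X i) = 0.
Proof.
case=> _ _ [P [C [k [k_gt1 rC sumC eX]]]].
pose o n : 'I_4 := inord n.
have oE n (hn : (n < 4)%N) : Ordinal hn = o n.
  by apply/val_inj; rewrite /= inordK.
have big4 (V : nmodType) (F : 'I_4 -> V) :
    \sum_j F j = F (o 0) + F (o 1) + F (o 2) + F (o 3).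
  rewrite !big_ord_recr big_ord0 /= add0r.
  by congr (F _ + F _ + F _ + F _); apply/val_inj; rewrite /= inordK.
have eX0 : X (o 0) = P + k (o 0) *: C (o 0).
  by rewrite eX big_mkcond big4 !inordK // !addr0.
have eX1 : X (o 1) = P + C (o 0) + k (o 1) *: C (o 1).
  by rewrite eX big_mkcond big4 !inordK //= !addr0.
have eX2 : X (o 2) = P + C (o 0) + C (o 1) + k (o 2) *: C (o 2).
  by rewrite eX big_mkcond big4 !inordK //= !addr0 !addrA.
have eX3 : X (o 3) = P + C (o 0) + C (o 1) + C (o 2) + k (o 3) *: C (o 3).
  by rewrite eX big_mkcond big4 !inordK //= !addr0 !addrA.
rewrite big4 in sumC.
have weights (a b c d : 'I_4) (l1 l2 l3 : R) :
    perm_eq [:: a; b; c; d] (enum 'I_4) ->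
    0 < l1 -> 0 < l2 -> 0 < l3 ->
    (forall r s, l1 * minor r s (X b - X a) + l2 * minor r s (X c - X a)
      + l3 * minor r s (X d - X a) = 0) ->
    exists l : 'I_4 -> R, (forall j, 0 < l j) /\
      forall r s, \sum_j l j * minor r s (X j - X a) = 0.
  move=> abcd l1_gt0 l2_gt0 l3_gt0 sum0.
  have /= := perm_uniq abcd; rewrite enum_uniq !inE !negb_or !andbT.
  move=> /and3P[/and3P[ab ac ad] /andP[bc bd] cd].
  exists (fun j => if j == d then l3 else if j == c then l2 else l1).
  split=> [j|r s]; first by do 2![case: ifP => // _].
  rewrite -big_enum -(perm_big _ abcd) /= !big_cons big_nil.
  rewrite eqxx (negPf ad) (negPf ac) (negPf bd) (negPf bc) (negPf cd) eqxx.
  by rewrite subrr {1}/minor !mxE mul0r subrr mulr0 add0r addr0 addrA.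
have perm4 a b c d : perm_eq [:: a; b; c; d] (iota 0 4) ->
    perm_eq [:: o a; o b; o c; o d] (enum 'I_4).
  move=> abcd; apply: (perm_map_inj (@ord_inj 4)); rewrite val_enum_ord.
  have lt4 n : n \in [:: a; b; c; d] -> (n < 4)%N.
    by rewrite (perm_mem abcd) mem_iota.
  by rewrite /= !inordK ?lt4 ?inE ?eqxx ?orbT.
have turn1 : P + C (o 0) + C (o 1) + C (o 2) + C (o 3) = P.
  by rewrite -!(addrA P) sumC addr0.
case=> [[|[|[|[|n]]]] //= hi]; rewrite oE.
- have [] := @T4_loop R P (C (o 0)) (C (o 1)) (C (o 2)) (C (o 3))
    (X (o 0)) (X (o 1)) (X (o 2)) (X (o 3))
    (k (o 0)) (k (o 1)) (k (o 2)) (k (o 3)) => //.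
  by move=> l1 [l2 [l3 [p1 p2 p3 E]]]; apply: weights E => //; exact: perm4.
- have [] := @T4_loop R (P + C (o 0)) (C (o 1)) (C (o 2)) (C (o 3)) (C (o 0))
    (X (o 1)) (X (o 2)) (X (o 3)) (X (o 0))
    (k (o 1)) (k (o 2)) (k (o 3)) (k (o 0)) => //.
  + by rewrite addrC !addrA.
  + by rewrite turn1.
  by move=> l1 [l2 [l3 [p1 p2 p3 E]]]; apply: weights E => //; exact: perm4.
- have [] := @T4_loop R (P + C (o 0) + C (o 1))
    (C (o 2)) (C (o 3)) (C (o 0)) (C (o 1))
    (X (o 2)) (X (o 3)) (X (o 0)) (X (o 1))
    (k (o 2)) (k (o 3)) (k (o 0)) (k (o 1)) => //.
  + by rewrite -addrA addrC addrA.
  + by rewrite turn1.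
  + by rewrite turn1.
  by move=> l1 [l2 [l3 [p1 p2 p3 E]]]; apply: weights E => //; exact: perm4.
- have [] := @T4_loop R (P + C (o 0) + C (o 1) + C (o 2))
    (C (o 3)) (C (o 0)) (C (o 1)) (C (o 2))
    (X (o 3)) (X (o 0)) (X (o 1)) (X (o 2))
    (k (o 3)) (k (o 0)) (k (o 1)) (k (o 2)) => //.
  + by rewrite -!(addrA (C (o 3))) addrC.
  + by rewrite turn1.
  + by rewrite turn1.
  + by rewrite turn1.
  by move=> l1 [l2 [l3 [p1 p2 p3 E]]]; apply: weights E => //; exact: perm4.
Qed.

(** The three minors of G(W) - G(U): [minor_uu] is zero when the jump from U to
    W satisfies the Rankine-Hugoniot conditions, and the other two pair the
    entropy with one of the conserved variables. *)
Definition minor_uu (R : realType) (f : R * R -> R * R) (U W : R * R) : R :=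
  (W.1 - U.1) * ((f W).2 - (f U).2) - ((f W).1 - (f U).1) * (W.2 - U.2).

Definition minor_1eta (R : realType) (f : R * R -> R * R)
    (eta q : R * R -> R) (U W : R * R) : R :=
  (W.1 - U.1) * (q W - q U) - ((f W).1 - (f U).1) * (eta W - eta U).

Definition minor_2eta (R : realType) (f : R * R -> R * R)
    (eta q : R * R -> R) (U W : R * R) : R :=
  (W.2 - U.2) * (q W - q U) - ((f W).2 - (f U).2) * (eta W - eta U).

Lemma T4_states (R : realType) (V : set (R * R)) (f : R * R -> R * R)
    (eta q : R * R -> R) (X : 'I_4 -> 'M[R]_(3, 2)) :
  T4_configuration X -> (forall i, Kset V f eta q (X i)) ->
  exists (U : 'I_4 -> R * R) (l : 'I_4 -> 'I_4 -> R),
    [/\ injective U, forall i, V (U i), forall i j, 0 < l i j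
      & forall i, [/\ \sum_j l i j * minor_uu f (U i) (U j) = 0,
          \sum_j l i j * minor_1eta f eta q (U i) (U j) = 0
        & \sum_j l i j * minor_2eta f eta q (U i) (U j) = 0]].
Proof.
move=> T4 XK.
have [i|U UP] := boolp.choice (P := fun i W => V W /\ X i = Gmx f eta q W).
  by have [W VW <-] := XK i; exists W.
have [l lP] := boolp.choice (T4_minor_weights T4).
exists U, l; split => [i j Uij|i|i j|i].
- case: T4 => X_inj _ _; apply: X_inj.
  by have [_ ->] := UP i; have [_ ->] := UP j; rewrite Uij.
- by have [] := UP i.
- by have [] := lP i.
have [_ sum0] := lP i.
have eX j : X j = Gmx f eta q (U j) by have [] := UP j.
split; [apply: etrans (sum0 (inord 0) (inord 1))
  |apply: etrans (sum0 (inord 0) (inord 2))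
  |apply: etrans (sum0 (inord 1) (inord 2))];
  by apply: eq_bigr => j _; congr (_ * _); rewrite /minor !eX !mxE !inordK.
Qed.

(** * The sign pattern of four states in Lagrangian variables *)

Lemma sorted_labelling (R : realType) n (x : 'I_n -> R) :
  exists2 s : 'I_n -> 'I_n, bijective s &
    forall i j : 'I_n, (i <= j)%N -> x (s i) <= x (s j).
Proof.
pose le_x : rel 'I_n := relpre x <=%O.
pose t := sort le_x (enum 'I_n).
have szt : size t = n by rewrite size_sort size_enum_ord.
have tP : sorted le_x t by apply: sort_sorted => i j; exact: le_total.
have le_tr : transitive le_x by move=> i j k; exact: le_trans.
exists (fun i => nth i t i).
  apply: injF_bij => i j /eqP.
  rewrite (@set_nth_default _ t j i i) ?szt // nth_uniq ?szt //;
    last by rewrite sort_uniq enum_uniq.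
  by move=> /eqP /ord_inj.
move=> i j ij; rewrite (@set_nth_default _ t j i i) ?szt //.
have le_refl : reflexive le_x by move=> k; exact: lexx.
by apply: (sorted_leq_nth le_tr le_refl j tP); rewrite ?inE ?szt.
Qed.

(** Number the points 0, 1, 2, 3 in the order of x; each of them has a negative
    link to some k and a positive link to some j with k before j.
    If d 0 3 <= 0, the pattern at 0 must be d 0 1 < 0 < d 0 2; then the pattern
    at 2 can only use the negative link d 2 1 < 0, and transitivity along
    0, 1, 2 contradicts 0 < d 0 2.
    If d 0 3 > 0, the pattern at 3 must be d 3 1 < 0 < d 3 2; so d 0 1 > 0, by
    transitivity along 0, 1, 3; now the pattern at 1 needs a positive link to a
    point after some k > 1, that is to 3, contradicting d 3 1 < 0. *)
Lemma no_four_point_pattern (R : realType) (x : 'I_4 -> R)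
    (d : 'I_4 -> 'I_4 -> R) :
  (forall i, d i i = 0) -> (forall i j, d i j = d j i) ->
  (forall i j k, x i <= x j -> x j <= x k ->
     d i j <= 0 -> d j k <= 0 -> d i k <= 0) ->
  (forall i, exists j k, [/\ x k < x j, d i k < 0 & 0 < d i j]) -> False.
Proof.
move=> d_diag d_sym d_trans d_pattern.
have [s [s' s'K sK] s_mono] := sorted_labelling x.
pose D i j := d (s (inord i)) (s (inord j)).
have D_sym i j : D i j = D j i by exact: d_sym.
have trans i j k : (i <= j)%N -> (j <= k)%N -> (k < 4)%N ->
    D i j <= 0 -> D j k <= 0 -> D i k <= 0.
  move=> ij jk k4; apply: d_trans; apply: s_mono;
  by rewrite !inordK //; lia.
have pattern i : (i < 4)%N -> exists j k,
    [/\ (k < j < 4)%N, k != i, j != i, D i k < 0 & 0 < D i j].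
  move=> i4; have [j [k [kj ik ij]]] := d_pattern (s (inord i)).
  exists (s' j), (s' k); rewrite /D !inord_val !sK; split => //.
  - rewrite ltn_ord andbT ltnNge; apply/negP => /s_mono.
    by rewrite !sK leNgt kj.
  - by apply: contraTneq ik => <-; rewrite inord_val sK d_diag ltxx.
  - by apply: contraTneq ij => <-; rewrite inord_val sK d_diag ltxx.
have [d03|d03] := lerP (D 0 3) 0.
  have [j [k [kj k0 j0 neg pos]]] := pattern 0%N isT.
  have [ej ek] : j = 2%N /\ k = 1%N.
    have : j != 3 by apply: contraTneq pos => ->; rewrite -leNgt.
    by move=> ?; lia.
  rewrite {}ej {}ek {j k kj k0 j0} in neg pos.
  have [j [k [kj k0 j0 neg' pos']]] := pattern 2%N isT.
  have k1 : k = 1%N.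
    have : k != 0 by apply: contraTneq neg' => ->; rewrite -leNgt D_sym ltW.
    by move=> ?; lia.
  rewrite {}k1 D_sym in neg'.
  by have := trans 0 1 2 isT isT isT (ltW neg) (ltW neg'); rewrite leNgt pos.
have [j [k [kj k0 j0 neg pos]]] := pattern 3%N isT.
have [ej ek] : j = 2%N /\ k = 1%N.
  have : k != 0 by apply: contraTneq neg => ->; rewrite -leNgt D_sym ltW.
  by move=> ?; lia.
rewrite {}ej {}ek {j k kj k0 j0} in neg pos.
have d01 : 0 < D 0 1.
  rewrite ltNge; apply: contraTN d03 => d01; rewrite -leNgt.
  by apply: (trans 0 1 3) => //; rewrite D_sym ltW.
have [j [k [kj k0 j0 neg' pos']]] := pattern 1%N isT.
have ej : j = 3%N.
  have : k != 0 by apply: contraTneq neg' => ->; rewrite -leNgt D_sym ltW.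
  by move=> ?; lia.
by move: pos'; rewrite ej D_sym ltNge ltW.
Qed.

(** As the weights have sum zero, y may be shifted by its least value on the
    positive weights; all terms then become nonnegative. *)
Lemma weighted_sum_ge0 (R : realType) n (s y : 'I_n -> R) :
  \sum_i s i = 0 ->
  (forall j k, 0 < s j -> s k < 0 -> y k <= y j) ->
  0 <= \sum_i s i * y i.
Proof.
move=> sum0 s_y.
have [/existsP[j0 sj0]|/existsPn s_le0] := boolP [exists j, 0 < s j].
  have [j sj y_min] := @arg_minP _ _ _ j0 (fun j => 0 < s j) y sj0.
  have -> : \sum_i s i * y i = \sum_i s i * (y i - y j).
    under [RHS]eq_bigr do rewrite mulrBr.
    by rewrite sumrB -mulr_suml sum0 mul0r subr0.
  apply: sumr_ge0 => k _.
  have [sk|sk|<-] := ltgtP 0 (s k); last by rewrite mul0r.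
    by rewrite mulr_ge0 ?subr_ge0 ?y_min // ltW.
  by rewrite mulr_le0 ?subr_le0 ?s_y // ltW.
rewrite big1 // => i _; suff -> : s i = 0 by rewrite mul0r.
apply: oppr_inj; rewrite oppr0.
apply: (psumr_eq0P (P := xpredT) (F := fun i => - s i)) => //.
  by move=> k _; rewrite oppr_ge0 leNgt.
by rewrite sumrN sum0 oppr0.
Qed.

(** In the form of Cauchy-Schwarz: if |w| <= sqrt(a (-b)) and
    |w'| <= sqrt(a' (-b')) then |w + w'| <= sqrt((a + a') (- b - b')). *)
Lemma timelike_trans (R : realType) (a b w a' b' w' : R) :
  0 <= a -> b <= 0 -> 0 <= a' -> b' <= 0 ->
  w ^+ 2 + a * b <= 0 -> w' ^+ 2 + a' * b' <= 0 ->
  (w + w') ^+ 2 + (a + a') * (b + b') <= 0.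
Proof.
move=> a0 b0 a'0 b'0 h h'.
suff : 2 * (w * w') <= - (a * b' + a' * b) by nra.
have m0 : 0 <= - (a * b' + a' * b).
  by have := mulr_ge0_le0 a0 b'0; have := mulr_ge0_le0 a'0 b0; lra.
have prod : (w * w') ^+ 2 <= (a * b) * (a' * b').
  rewrite exprMn -[leRHS]mulrNN.
  by apply: ler_pM; rewrite ?sqr_ge0 //; lra.
apply: le_trans (ler_norm _) _.
rewrite -(ler_pXn2r (n := 2)) ?nnegrE ?normr_ge0 //.
rewrite real_normK ?num_real //.
have := sqr_ge0 (a * b' - a' * b); nra.
Qed.

(** The two balance laws say that, around each state i, the weights
    mu_ij d_ij have sum zero and that sg p has, for them, the mean
    2 sum_j mu_ij sg (p_j - p_i) e_ij.  The latter is negative because e_ij has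
    the sign of sg (tau_j - tau_i), opposite to that of sg (p_j - p_i).  This
    yields the links that [no_four_point_pattern] excludes, with
    x = sg tau. *)
Lemma no_T4_lagrangian (R : realType) (sg : R) (tau u : 'I_4 -> R)
    (p : R -> R) (e mu : 'I_4 -> 'I_4 -> R) :
  (sg = 1 \/ sg = -1) ->
  (forall i j, tau i < tau j -> p (tau j) < p (tau i)) ->
  (forall i j, tau i < tau j -> 0 < sg * e i j) ->
  (forall i j, e j i = - e i j) ->
  (forall i j, tau i = tau j -> u i = u j -> i = j) ->
  (forall i j, 0 < mu i j) ->
  let d i j := (u j - u i) ^+ 2 + (tau j - tau i) * (p (tau j) - p (tau i)) in
  (forall i, \sum_j mu i j * d i j = 0) ->
  (forall i,
     \sum_j mu i j * ((p (tau j) - p (tau i)) * (d i j / 2 - e i j)) = 0) ->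
  False.
Proof.
move=> sgP p_decr e_gt0 e_anti inj mu_gt0 d sum_d sum_e.
have p_noninc i j : tau i <= tau j -> p (tau j) <= p (tau i).
  by rewrite le_eqVlt => /predU1P[->//|/p_decr/ltW].
have be_lt0 i j : tau i != tau j -> sg * ((p (tau j) - p (tau i)) * e i j) < 0.
  have [ij|ij|//] := ltgtP (tau i) (tau j) => _;
    have := p_decr _ _ ij; have := e_gt0 _ _ ij.
    nra.
  rewrite (e_anti i j); nra.
have be_le0 i j : sg * ((p (tau j) - p (tau i)) * e i j) <= 0.
  have [/eqP ->|/be_lt0/ltW //] := boolP (tau i == tau j).
  by rewrite subrr mul0r mulr0.
apply: (@no_four_point_pattern R (fun i => sg * tau i) d).
- by move=> i; rewrite /d !subrr; ring.
- by move=> i j; rewrite /d; ring.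
- move=> i j k ij jk dij djk.
  have split_d : d i k = ((u j - u i) + (u k - u j)) ^+ 2 +
      ((tau j - tau i) + (tau k - tau j)) *
      ((p (tau j) - p (tau i)) + (p (tau k) - p (tau j))) by rewrite /d; ring.
  have [s1|s1] := sgP; rewrite s1 ?mul1r ?mulN1r ?lerN2 in ij jk.
    rewrite split_d; apply: timelike_trans => //;
    by rewrite ?subr_ge0 ?subr_le0 // p_noninc.
  have -> : d i k = ((u j - u i) + (u k - u j)) ^+ 2 +
      ((tau i - tau j) + (tau j - tau k)) *
      ((p (tau i) - p (tau j)) + (p (tau j) - p (tau k))) by rewrite /d; ring.
  apply: timelike_trans; rewrite ?subr_ge0 ?subr_le0 //; try exact: p_noninc.
    by move: dij; rewrite /d; nra.
  by move: djk; rewrite /d; nra.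
move=> i.
(* Strictly negative unless all tau agree; but then d_ij = (u_j - u_i)^2 and
   the first balance law makes the states coincide. *)
have neg : \sum_j (mu i j * d i j) * (sg * p (tau j)) < 0.
  have -> : \sum_j (mu i j * d i j) * (sg * p (tau j)) =
      2 * \sum_j mu i j * (sg * ((p (tau j) - p (tau i)) * e i j)).
    apply/eqP; rewrite -subr_eq0; apply/eqP.
    transitivity (sg * p (tau i) * (\sum_j mu i j * d i j) + 2 * sg *
      (\sum_j mu i j * ((p (tau j) - p (tau i)) * (d i j / 2 - e i j)))).
      rewrite !mulr_sumr -sumrB -big_split /=.
      by apply: eq_bigr => j _; field.
    by rewrite sum_d sum_e !mulr0 addr0.
  have [/existsP[j ij]|/existsPn same] := boolP [exists j, tau i != tau j].
    rewrite pmulr_rlt0 // (bigD1 j) //= ltr_wnDr //.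
      by apply: sumr_le0 => k _; rewrite pmulr_rle0.
    by rewrite pmulr_rlt0 // be_lt0.
  have eq_tau j : tau i = tau j by apply/eqP; rewrite -[_ == _]negbK same.
  have : \sum_j mu i j * (u j - u i) ^+ 2 == 0.
    rewrite -[X in _ == X](sum_d i); apply/eqP/eq_bigr => j _.
    by rewrite /d -eq_tau subrr mul0r addr0.
  rewrite psumr_eq0 => [/allP sq0|j _]; last by rewrite mulr_ge0 ?sqr_ge0 ?ltW.
  have all_i j : i = j.
    apply: inj => //; have := sq0 j (mem_index_enum _).
    by rewrite mulf_eq0 gt_eqF //= sqrf_eq0 subr_eq0 => /eqP.
  by have := etrans (esym (all_i ord0)) (all_i ord_max).
have : ~ (forall j k, 0 < mu i j * d i j -> mu i k * d i k < 0 ->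
    sg * p (tau k) <= sg * p (tau j)).
  by move=> /(weighted_sum_ge0 (sum_d i)); rewrite leNgt neg.
move=> /existsNP[j /existsNP[k /not_implyP[pos /not_implyP[nega /negP]]]].
rewrite -ltNge => p_jk; exists j, k; split.
- have [s1|s1] := sgP; rewrite s1 ?mul1r ?mulN1r ?ltrN2 in p_jk *;
  by rewrite ltNge; apply: contraTN p_jk => /p_noninc; rewrite -leNgt.
- by rewrite -(pmulr_rlt0 _ (mu_gt0 i k)).
- by rewrite -(pmulr_rgt0 _ (mu_gt0 i j)).
Qed.

(** * One-variable calculus *)

Lemma derivable_is_derive1 (R : realType) (f : R -> R) (x : R) :
  derivable f x 1 -> is_derive x 1 f (f^`() x).
Proof. by rewrite derive1E => /derivableP. Qed.

Lemma is_derive_continuous_within (R : realType) (f df : R -> R)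
    (I : interval R) :
  (forall x, x \in I -> is_derive x 1 f (df x)) ->
  {within [set` I], continuous f}.
Proof.
move=> f_df; apply: derivable_within_continuous => x xI.
by have [] := f_df x xI.
Qed.

Lemma mean_value (R : realType) (f df : R -> R) (a b : R) : a < b ->
  (forall x, a <= x <= b -> is_derive x 1 f (df x)) ->
  exists c, [/\ a < c, c < b & f b - f a = df c * (b - a)].
Proof.
move=> ab f_df.
have [x||c] := @MVT R f df a b ab; last first.
- by rewrite in_itv /= => /andP[ac cb] fc; exists c.
- by apply: (@is_derive_continuous_within R f df) => x;
    rewrite in_itv; exact: f_df.
- by rewrite in_itv /= => /andP[ax xb]; apply: f_df; rewrite !ltW.
Qed.

(** By the mean value theorem f is injective, and a continuous injective
    function on an interval is strictly monotone. *)
Lemma derive_neq0_monotone (R : realType) (I : interval R) (f df : R -> R) :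
  (forall x, x \in I -> is_derive x 1 f (df x)) ->
  (forall x, x \in I -> df x != 0) ->
  exists2 sg : R, sg = 1 \/ sg = -1 &
    {in I &, forall x y, x < y -> sg * f x < sg * f y}.
Proof.
move=> f_df df_neq0.
have inj_lt x y : x \in I -> y \in I -> x < y -> f x != f y.
  move=> xI yI xy; apply/eqP => fxy.
  have inI z : x <= z <= y -> z \in I.
    by move=> /andP[xz zy]; apply: (interval_is_interval xI yI); rewrite xz zy.
  have [z /inI zI|z [xz zy]] := mean_value xy (df := df) (f := f).
    exact: f_df.
  rewrite fxy subrr => /esym/eqP; rewrite mulf_eq0 subr_eq0 (gt_eqF xy) orbF.
  by apply/negP/df_neq0/inI; rewrite !ltW.
have inj : {in I &, injective f}.
  move=> x y xI yI fxy; have [xy|xy|//] := ltgtP x y.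
    by have := inj_lt x y xI yI xy; rewrite fxy eqxx.
  by have := inj_lt y x yI xI xy; rewrite fxy eqxx.
have [mono|mono] :=
  itv_continuous_inj_mono (is_derive_continuous_within f_df) inj.
- exists 1; first by left.
  by move=> x y xI yI; rewrite !mul1r; exact: mono.
- exists (-1); first by right.
  by move=> x y xI yI; rewrite !mulN1r ltrN2; exact: mono.
Qed.

(** As a function of y, twice the error has the derivative
    (y - x) p'(y) - (p(y) - p(x)) = (y - x) (p'(y) - p'(w)) for some w between
    x and y, which has the sign of sg. *)
Lemma trapezoid_error (R : realType) (sg : R) (p dp A : R -> R) (x y : R) :
  x < y ->
  (forall z, x <= z <= y -> is_derive z 1 p (dp z)) ->
  (forall z, x <= z <= y -> is_derive z 1 A (p z)) ->
  (forall z w, x <= z -> z < w -> w <= y -> sg * dp z < sg * dp w) ->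
  0 < sg * ((y - x) * (p x + p y) / 2 - (A y - A x)).
Proof.
move=> xy p_dp A_p dp_mono.
pose err z := (z - x) * (p x + p z) / 2 - (A z - A x).
pose derr z := (p x + p z) / 2 + (z - x) * dp z / 2 - p z.
have err_der z : x <= z <= y -> is_derive z 1 err (derr z).
  move=> xzy; have hp := p_dp z xzy; have hA := A_p z xzy.
  by apply: is_derive_eq; rewrite /derr /GRing.scale /=; field.
have [z [xz zy err_z]] := mean_value xy err_der.
have err_x : err x = 0 by rewrite /err !subrr; ring.
have [z' /andP[? ?]|w [xw wz pw]] := mean_value xz (f := p) (df := dp).
  by apply: p_dp; apply/andP; split=> //; lra.
have -> : sg * ((y - x) * (p x + p y) / 2 - (A y - A x)) =
    (sg * dp z - sg * dp w) * (z - x) * (y - x) / 2.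
  rewrite -/(err y) -[err y]subr0 -err_x err_z /derr.
  have -> : p z = p x + dp w * (z - x) by rewrite -pw; ring.
  by field.
have := dp_mono w z (ltW xw) wz (ltW zy) => ?.
by rewrite divr_gt0 // !mulr_gt0 // subr_gt0.
Qed.

Lemma is_derive_recip (R : realType) (f : R -> R) (df t : R) :
  t != 0 -> is_derive t^-1 1 f df ->
  is_derive t 1 (fun s => f s^-1) (- t ^- 2 * df).
Proof.
move=> t_neq0 f_df.
have inv_der : is_derive t 1 (fun s : R => s^-1) (- t ^- 2).
  apply: is_derive_eq (is_deriveV (f := id) _ _) _ => //.
  by rewrite /GRing.scale /= mulr1.
rewrite mulrC; exact: (@is_derive1_comp R f (fun s => s^-1) t).
Qed.

Lemma eq_pos_derive (R : realType) (f g : R -> R) (r df : R) :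
  (forall s : R, 0 < s -> g s = f s) -> 0 < r ->
  is_derive r 1 f df -> is_derive r 1 g df.
Proof.
move=> fg r0; apply: near_eq_is_derive.
by near=> s; apply/esym/fg; near: s; exact: lt_nbhsr.
Unshelve. all: by end_near. Qed.

(** Convexity bounds the difference quotient at x in the direction of y by
    g y - g x, hence also its limit.  This weak inequality at the midpoint of x
    and y, with strict convexity there, gives the strict one at y. *)
Lemma strictly_convex_tangent (R : realType) (g : R -> R) (dg x y : R) :
  strictly_convex g -> is_derive x 1 g dg -> x != y ->
  dg * (y - x) < g y - g x.
Proof.
move=> g_cvx g_d.
have tangent z : dg * (z - x) <= g z - g x.
  have [->|xz] := eqVneq x z; first by rewrite !subrr mulr0.
  pose F (t : R) := g (t * (z - x) + x).
  have F_d : is_derive (0 : R) 1 F (dg * (z - x)).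
    pose line (t : R) := t * (z - x) + x.
    have line_d : is_derive (0 : R) 1 line (z - x).
      by apply: is_derive_eq; rewrite /GRing.scale /=; ring.
    by apply: (@is_derive1_comp R g line) => //; rewrite /line mul0r add0r.
  have F_der : derivable F (0 : R) 1 by have [] := F_d.
  have <- : 'D_1 F (0 : R) = dg * (z - x) by rewrite derive_val.
  rewrite ['D_1 F _]cvg_at_rightE; last exact: F_der.
  apply: limr_le.
    rewrite -(cvg_at_rightE (fun h : R => h^-1 *: ((F \o shift 0) _ - F 0))) //.
    apply: cvg_trans F_der; apply: cvg_app.
    move=> A [e e0 Ae]; exists e => // t te t0.
    by apply: Ae => //; exact/lt0r_neq0.
  near=> t.
  have t0 : 0 < t by near: t; exact: nbhs_right_gt.
  have t1 : t < 1 by near: t; exact: nbhs_right_lt.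
  rewrite /GRing.scale /= mulr1 addr0 /F mul0r add0r ler_pdivrMl //.
  have := g_cvx z x t; rewrite eq_sym xz => /(_ isT t0 t1).
  have -> : t * (z - x) + x = t * z + (1 - t) * x by ring.
  lra.
move=> xy; have half_gt0 : 0 < 2^-1 :> R by rewrite invr_gt0.
have half_lt1 : 2^-1 < 1 :> R by rewrite invf_lt1 ?ltr1n.
have := g_cvx x y 2^-1 xy half_gt0 half_lt1.
have := tangent (2^-1 * x + (1 - 2^-1) * y).
lra.
Unshelve. all: by end_near. Qed.

Lemma strictly_convex_derive_lt (R : realType) (g dg : R -> R) :
  strictly_convex g -> (forall x : R, is_derive x 1 g (dg x)) ->
  forall x y : R, x < y -> dg x < dg y.
Proof.
move=> g_cvx g_d x y xy.
have := strictly_convex_tangent g_cvx (g_d x) (negbT (lt_eqF xy)).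
have := strictly_convex_tangent g_cvx (g_d y) (negbT (gt_eqF xy)).
nra.
Qed.

(** * The p-system *)

Lemma no_T4_p_system (R : realType) (p A : R -> R) (X : 'I_4 -> 'M[R]_(3, 2)) :
  (forall v : R, derivable p v 1) -> (forall v : R, derivable p^`() v 1) ->
  (forall v : R, p^`() v < 0) -> (forall v : R, p^`(2) v != 0) ->
  (forall v : R, is_derive v 1 A (p v)) -> T4_configuration X ->
  ~ forall i, Kset [set: R * R] (p_flux p) (fun U => U.2 ^+ 2 / 2 - A U.1)
      (fun U => U.2 * p U.1) (X i).
Proof.
move=> p_d dp_d dp_lt0 ddp_neq0 A_p T4.
move=> /(T4_states T4)[U [l [U_inj _ l_gt0 sum0]]].
have p_dp (v : R) : is_derive v 1 p (p^`() v) by exact: derivable_is_derive1.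
have dp_ddp (v : R) : is_derive v 1 p^`() (p^`(2) v).
  exact: derivable_is_derive1.
have [sg sgP dp_mono] := derive_neq0_monotone (I := `]-oo, +oo[%R)
  (fun x _ => dp_ddp x) (fun x _ => ddp_neq0 x).
pose tau i := (U i).1; pose u i := (U i).2.
pose e i j := (tau j - tau i) * (p (tau i) + p (tau j)) / 2 -
  (A (tau j) - A (tau i)).
apply: (@no_T4_lagrangian R sg tau u p e l sgP) => //.
- move=> i j ij; have [c [_ _ pc]] := mean_value ij (fun z _ => p_dp z).
  by rewrite -subr_lt0 pc nmulr_rlt0 ?subr_gt0.
- move=> i j ij.
  apply: (@trapezoid_error R sg p p^`() A) => // z w _ zw _.
  by apply: dp_mono; rewrite ?in_itv.
- by move=> i j; rewrite /e; field.
- move=> i j; rewrite /tau /u => eq1 eq2; apply: U_inj.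
  by rewrite (surjective_pairing (U i)) eq1 eq2 -surjective_pairing.
- move=> i; have [uu _ _] := sum0 i; rewrite -{}[RHS]uu; apply: eq_bigr => j _.
  by rewrite /minor_uu /p_flux /= /tau /u; ring.
- move=> i; have [uu _ ueta] := sum0 i.
  (* Subtracting p (tau i) times row 1 removes the tau-derivative of the
     entropy at U i. *)
  transitivity (\sum_j l i j * minor_2eta (p_flux p)
        (fun U => U.2 ^+ 2 / 2 - A U.1) (fun U => U.2 * p U.1) (U i) (U j)
      - p (tau i) * \sum_j l i j * minor_uu (p_flux p) (U i) (U j)).
    rewrite mulr_sumr -sumrB; apply: eq_bigr => j _.
    by rewrite /minor_uu /minor_2eta /p_flux /= /e /tau /u; field.
  by rewrite uu ueta mulr0 subr0.
Qed.

(** * Isentropic Euler equations *)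

(** P and the Legendre transform r S' - S have the same derivative r S''. *)
Lemma enthalpy_pressure (R : realType) (P P1 S S1 : R -> R) :
  (forall r : R, 0 < r -> is_derive r 1 P (P1 r)) ->
  (forall r : R, 0 < r -> is_derive r 1 S (S1 r)) ->
  (forall r : R, 0 < r -> is_derive r 1 S1 (r^-1 * P1 r)) ->
  exists K : R, forall r : R, 0 < r -> P r = r * S1 r - S r + K.
Proof.
move=> P_d S_d S1_d; pose F (r : R) : R := P r - r * S1 r + S r.
have F_d (r : R) : 0 < r -> is_derive r 1 F 0.
  move=> r0; have hP := P_d r r0; have hS := S_d r r0; have hS1 := S1_d r r0.
  apply: is_derive_eq; rewrite /GRing.scale /=; field.
  by rewrite gt_eqF.
have F_const (a b : R) : 0 < a -> a < b -> F b = F a.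
  move=> a0 ab.
  have [z /andP[az _]|c [_ _]] := mean_value ab (f := F) (df := cst 0).
    by apply: F_d; apply: lt_le_trans az.
  by rewrite mul0r => /subr0_eq.
exists (F 1) => r r0; suff -> : F 1 = F r by rewrite /F; ring.
by have [r1|r1|->//] := ltgtP r 1; [|apply/esym]; exact: F_const.
Qed.

(** Passage to Lagrangian variables.  The pressure as a function of
    tau = 1 / rho is p, and A is an antiderivative of p by
    [enthalpy_pressure]: - A is the specific internal energy, up to the
    integration constant K. *)
Lemma no_T4_euler (R : realType) (P P1 P2 S S1 : R -> R)
    (eta q : R * R -> R) (X : 'I_4 -> 'M[R]_(3, 2)) :
  (forall r : R, 0 < r -> is_derive r 1 P (P1 r)) ->
  (forall r : R, 0 < r -> is_derive r 1 P1 (P2 r)) ->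
  (forall r : R, 0 < r -> 0 < P1 r) ->
  (forall r : R, 0 < r -> r * P2 r + 2 * P1 r != 0) ->
  (forall r : R, 0 < r -> is_derive r 1 S (S1 r)) ->
  (forall r : R, 0 < r -> is_derive r 1 S1 (r^-1 * P1 r)) ->
  (forall U : R * R, 0 < U.1 -> eta U = U.1 * velocity U ^+ 2 / 2 + S U.1) ->
  (forall U : R * R, 0 < U.1 ->
     q U = U.1 * velocity U ^+ 3 / 2 + U.1 * velocity U * S1 U.1) ->
  T4_configuration X ->
  ~ forall i, Kset away_from_vacuum (euler_flux P) eta q (X i).
Proof.
move=> P_d P1_d P1_gt0 gnl S_d S1_d etaE qE T4.
move=> /(T4_states T4)[U [l [U_inj U_gt0 l_gt0 sum0]]].
rewrite /away_from_vacuum /= in U_gt0.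
have [K PE] := enthalpy_pressure P_d S_d S1_d.
pose p t := P t^-1.
pose dp (t : R) : R := - t ^- 2 * P1 t^-1.
pose A (t : R) : R := K * t - t * S t^-1.
have p_dp (t : R) : 0 < t -> is_derive t 1 p (dp t).
  move=> t0; apply: is_derive_recip; first by rewrite gt_eqF.
  by apply: P_d; rewrite invr_gt0.
have A_p (t : R) : 0 < t -> is_derive t 1 A (p t).
  move=> t0; have t_neq0 : t != 0 by rewrite gt_eqF.
  have hS : is_derive t 1 (fun s => S s^-1) (- t ^- 2 * S1 t^-1).
    by apply: is_derive_recip => //; apply: S_d; rewrite invr_gt0.
  apply: is_derive_eq; rewrite /p PE ?invr_gt0 // /GRing.scale /=.
  by field.
pose ddp t := t ^- 3 * (t^-1 * P2 t^-1 + 2 * P1 t^-1).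
have dp_ddp (t : R) : 0 < t -> is_derive t 1 dp (ddp t).
  move=> t0; have t_neq0 : t != 0 by rewrite gt_eqF.
  have hP1 : is_derive t 1 (fun s => P1 s^-1) (- t ^- 2 * P2 t^-1).
    by apply: is_derive_recip => //; apply: P1_d; rewrite invr_gt0.
  have hsq : is_derive t 1 (fun s : R => - s ^- 2) (2 * t ^- 3).
    have hV := is_deriveV (f := fun s : R => s ^+ 2) (expf_neq0 2 t_neq0) _.
    by apply: is_derive_eq; rewrite /GRing.scale /=; field.
  apply: is_derive_eq; rewrite /ddp /GRing.scale /=.
  by field.
have dp_ddp_pos (t : R) : t \in `]0, +oo[%R -> is_derive t 1 dp (ddp t).
  by rewrite in_itv /= andbT; exact: dp_ddp.
have ddp_neq0 (t : R) : t \in `]0, +oo[%R -> ddp t != 0.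
  rewrite in_itv /= andbT => t0; rewrite mulf_neq0 ?gnl ?invr_gt0 //.
  by rewrite invr_eq0 expf_eq0 gt_eqF.
have [sg sgP dp_mono] := derive_neq0_monotone dp_ddp_pos ddp_neq0.
pose tau i := (U i).1^-1; pose u i := velocity (U i).
pose e i j := (tau j - tau i) * (p (tau i) + p (tau j)) / 2 -
  (A (tau j) - A (tau i)).
have U_neq0 i : (U i).1 != 0 by rewrite gt_eqF.
have tau_gt0 i : 0 < tau i by rewrite invr_gt0.
apply: (@no_T4_lagrangian R sg tau u p e (fun i j => l i j * (U j).1) sgP)
  => //.
- move=> i j ij.
  have [z /andP[iz _]|c [ic _ pc]] := mean_value ij (f := p) (df := dp).
    by apply: p_dp; apply: lt_le_trans iz.
  rewrite -subr_lt0 pc nmulr_rlt0 ?subr_gt0 // /dp mulNr oppr_lt0.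
  have c0 : 0 < c by exact: lt_trans ic.
  by rewrite mulr_gt0 ?P1_gt0 ?invr_gt0 ?exprn_gt0.
- move=> i j ij; have pos (z : R) : tau i <= z -> 0 < z by exact: lt_le_trans.
  apply: (@trapezoid_error R sg p dp A) => //.
  + by move=> z /andP[/pos z0 _]; exact: p_dp.
  + by move=> z /andP[/pos z0 _]; exact: A_p.
  + move=> z w /pos z0 zw _; apply: dp_mono; rewrite ?in_itv //= andbT //.
    exact: lt_trans zw.
- by move=> i j; rewrite /e; field.
- move=> i j /invr_inj eq1; rewrite /u /velocity eq1 => eq2.
  apply: U_inj; rewrite (surjective_pairing (U i)) eq1.
  by rewrite (mulIf _ eq2) ?invr_eq0 ?gt_eqF // -surjective_pairing.
- by move=> i j; rewrite mulr_gt0.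
- move=> i; have [uu _ _] := sum0 i.
  apply: (@mulfI _ (- (U i).1)); first by rewrite oppr_eq0 gt_eqF.
  rewrite mulr0 -{}[RHS]uu mulr_sumr; apply: eq_bigr => j _.
  rewrite /minor_uu /euler_flux /= /p /tau !invrK /u /velocity.
  by field; apply/andP; split; exact: U_neq0.
- move=> i; have [uu u1 u2] := sum0 i.
  (* The Galilean change to the frame moving with velocity u i, followed by
     the subtraction of S1 (U i).1 times row 1. *)
  transitivity (\sum_j l i j * minor_2eta (euler_flux P) eta q (U i) (U j)
      - u i * (\sum_j l i j * minor_1eta (euler_flux P) eta q (U i) (U j))
      + (u i ^+ 2 / 2 + S1 (U i).1) *
        \sum_j l i j * minor_uu (euler_flux P) (U i) (U j)).
    rewrite !mulr_sumr -sumrB -big_split; apply: eq_bigr => j _ /=.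
    rewrite /minor_uu /minor_1eta /minor_2eta /euler_flux /= /e /A.
    rewrite !etaE // !qE // /p /tau !invrK /u /velocity !PE //.
    by field; apply/andP; split; exact: U_neq0.
  by rewrite uu u1 u2 !mulr0 subr0 addr0.
Qed.

(** All derivatives may be computed on a smooth extension h of P, which agrees
    with P near every positive density. *)
Lemma no_T4_isentropic_euler (R : realType) (P S : R -> R)
    (X : 'I_4 -> 'M[R]_(3, 2)) :
  smooth_on [set rho : R | 0 <= rho] P ->
  (forall rho : R, 0 < rho -> 0 < P^`() rho) ->
  (forall rho : R, 0 < rho -> (fun r => r * P r)^`(2) rho != 0) ->
  (forall rho : R, 0 < rho -> derivable S rho 1) ->
  (forall rho : R, 0 < rho -> is_derive rho 1 S^`() (rho^-1 * P^`() rho)) ->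
  T4_configuration X ->
  ~ forall i, Kset away_from_vacuum (euler_flux P)
    (fun U => U.1 * velocity U ^+ 2 / 2 + S U.1)
    (fun U => U.1 * velocity U ^+ 3 / 2 + U.1 * velocity U * S^`() U.1) (X i).
Proof.
move=> [h h_smooth PE] P1_gt0 gnl S_d S1_d T4.
have Ph (r : R) : 0 < r -> P r = h r by move=> r0; apply: PE; exact: ltW.
have h_d (r : R) : is_derive r 1 h (h^`() r).
  by apply: derivable_is_derive1; exact: (h_smooth 0).
have h1_d (r : R) : is_derive r 1 h^`() (h^`(2) r).
  by apply: derivable_is_derive1; exact: (h_smooth 1).
have P_d (r : R) : 0 < r -> is_derive r 1 P (h^`() r).
  by move=> r0; apply: (eq_pos_derive Ph) => //; exact: h_d.
have P1E (r : R) : 0 < r -> P^`() r = h^`() r.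
  by move=> /P_d hP; rewrite derive1E; exact: derive_val.
have rP_d (r : R) : 0 < r -> (fun s => s * P s)^`() r = h r + r * h^`() r.
  move=> r0; rewrite derive1E; have hP := P_d r r0.
  by rewrite derive_val /GRing.scale /= Ph //; ring.
have rP_dd (r : R) : 0 < r ->
    (fun s => s * P s)^`(2) r = r * h^`(2) r + 2 * h^`() r.
  move=> r0; rewrite derive1nS derive1E /=; apply: derive_val.
  apply: (eq_pos_derive rP_d) => //.
  have ? := h_d r; have ? := h1_d r.
  by apply: is_derive_eq; rewrite /GRing.scale /=; ring.
apply: (@no_T4_euler R P h^`() h^`(2) S S^`()) => //.
- by move=> r r0; rewrite -P1E // P1_gt0.
- by move=> r r0; rewrite -rP_dd // gnl.
- by move=> r r0; apply: derivable_is_derive1; exact: S_d.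
- by move=> r r0; rewrite -P1E //; exact: S1_d.
Qed.

(** The power law is in general not smooth at the vacuum, so
    [no_T4_isentropic_euler] does not cover it; [no_T4_euler] does. *)
Lemma no_T4_ideal_gas (R : realType) (kappa gamma : R)
    (X : 'I_4 -> 'M[R]_(3, 2)) :
  0 < kappa -> 1 < gamma -> T4_configuration X ->
  ~ forall i, Kset away_from_vacuum
    (euler_flux (fun rho => kappa * rho `^ gamma))
    (fun U => U.1 * velocity U ^+ 2 / 2 + kappa / (gamma - 1) * U.1 `^ gamma)
    (fun U => U.1 * velocity U ^+ 3 / 2
              + kappa * gamma / (gamma - 1) * U.1 `^ gamma * velocity U) (X i).
Proof.
move=> k_gt0 g_gt1.
have g1_neq0 : gamma - 1 != 0 by rewrite subr_eq0 gt_eqF.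
have pow_pred (r a : R) : 0 < r -> r * r `^ (a - 1) = r `^ a.
  move=> r0; rewrite -{1}(powRr1 (ltW r0)) -powRD ?subrKC //.
  by rewrite (gt_eqF r0) implybT.
have pow_d (c a r : R) : 0 < r ->
    is_derive r 1 (fun s : R => c * s `^ a) (c * a * r `^ (a - 1)).
  move=> r0; have ? := is_derive1_powR a r0.
  by apply: is_derive_eq; rewrite /GRing.scale /=; ring.
apply: (@no_T4_euler R _ (fun r => kappa * gamma * r `^ (gamma - 1))
  (fun r => kappa * gamma * (gamma - 1) * r `^ (gamma - 1 - 1))
  (fun r => kappa / (gamma - 1) * r `^ gamma)
  (fun r => kappa / (gamma - 1) * gamma * r `^ (gamma - 1))).
- by move=> r r0; rewrite !mulr_gt0 ?powR_gt0 //; lra.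
- move=> r r0.
  have -> : r * (kappa * gamma * (gamma - 1) * r `^ (gamma - 1 - 1))
    + 2 * (kappa * gamma * r `^ (gamma - 1))
    = kappa * gamma * (gamma + 1) * r `^ (gamma - 1).
    by rewrite mulrCA pow_pred //; ring.
  by rewrite gt_eqF // !mulr_gt0 ?powR_gt0 //; lra.
- move=> r r0; apply: is_derive_eq (pow_d _ _ _ r0) _.
  by rewrite -(pow_pred r (gamma - 1)) //; field; rewrite g1_neq0 gt_eqF.
- by [].
- move=> U U0; rewrite -(pow_pred _ gamma U0); field.
  exact: g1_neq0.
Qed.

(** * Coupled Burgers equations *)

(** The gap is the double integral of (df s - df t) (dh s - dh t) / 2 over
    s and t between x and y.  The proof replaces the integrals by mean values:
    with df c the slope of f between x and y, the gap is y - x times the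
    increment of K, whose derivative (dh - dh c) (df - df c) has the sign of
    sg on both sides of c. *)
Lemma chebyshev_gap (R : realType) (sg : R) (f df h dh Q : R -> R) :
  (forall x : R, is_derive x 1 f (df x)) ->
  (forall x : R, is_derive x 1 h (dh x)) ->
  (forall x : R, is_derive x 1 Q (dh x * df x)) ->
  (forall x y : R, x < y -> sg * df x < sg * df y) ->
  (forall x y : R, x < y -> dh x < dh y) ->
  forall x y : R, x != y ->
    0 < sg * ((y - x) * (Q y - Q x) - (f y - f x) * (h y - h x)).
Proof.
move=> f_d h_d Q_d df_mono dh_mono x y.
wlog xy : x y / x < y => [gap|_].
  have [xy|yx|//] := ltgtP x y => _; first by apply: gap => //; rewrite lt_eqF.
  by have := gap y x yx (negbT (lt_eqF yx)); congr (0 < sg * _); ring.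
have [c [xc cy fc]] := mean_value xy (fun z _ => f_d z).
pose K z := Q z - df c * h z - dh c * (f z - df c * z).
have K_d (z : R) : is_derive z 1 K ((dh z - dh c) * (df z - df c)).
  have ? := f_d z; have ? := h_d z; have ? := Q_d z.
  by apply: is_derive_eq; rewrite /GRing.scale /=; ring.
have [a [xa ac Ka]] := mean_value xc (fun z _ => K_d z).
have [b [cb yb Kb]] := mean_value cy (fun z _ => K_d z).
have -> : (y - x) * (Q y - Q x) - (f y - f x) * (h y - h x) =
    (y - x) * ((K y - K c) + (K c - K x)).
  have fy : f y = f x + df c * (y - x) by rewrite -fc; ring.
  by rewrite /K fy; ring.
rewrite mulrCA mulr_gt0 ?subr_gt0 // Ka Kb mulrDr addr_gt0 //.
  have := dh_mono _ _ cb; have := df_mono _ _ cb => h1 h2.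
  have -> : sg * ((dh b - dh c) * (df b - df c) * (y - c)) =
    (dh b - dh c) * (sg * df b - sg * df c) * (y - c) by ring.
  by rewrite !mulr_gt0 ?subr_gt0.
have := dh_mono _ _ ac; have := df_mono _ _ ac => h1 h2.
have -> : sg * ((dh a - dh c) * (df a - df c) * (c - x)) =
  (dh c - dh a) * (sg * df c - sg * df a) * (c - x) by ring.
by rewrite !mulr_gt0 ?subr_gt0.
Qed.

(** The bracket is the integral of (dg - dg x) (df - s) from x to y. *)
Lemma transverse_gap (R : realType) (tau s : R) (f df g dg Q : R -> R) :
  (forall x : R, is_derive x 1 f (df x)) ->
  (forall x : R, is_derive x 1 g (dg x)) ->
  (forall x : R, is_derive x 1 Q (dg x * df x)) ->
  (forall x, 0 < tau * (df x - s)) ->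
  (forall x y : R, x < y -> dg x < dg y) ->
  forall x y, 0 <= tau * ((Q y - Q x - dg x * (f y - f x))
                          - s * (g y - g x - dg x * (y - x))).
Proof.
move=> f_d g_d Q_d df_s dg_mono x y.
pose K z := Q z - dg x * f z - s * (g z - dg x * z).
have K_d (z : R) : is_derive z 1 K ((dg z - dg x) * (df z - s)).
  have ? := f_d z; have ? := g_d z; have ? := Q_d z.
  by apply: is_derive_eq; rewrite /GRing.scale /=; ring.
have -> : Q y - Q x - dg x * (f y - f x) - s * (g y - g x - dg x * (y - x))
  = K y - K x by rewrite /K; ring.
have [xy|yx|->] := ltgtP x y; last by rewrite subrr mulr0.
  have [c [xc _ ->]] := mean_value xy (fun z _ => K_d z).
  have -> : tau * ((dg c - dg x) * (df c - s) * (y - x)) =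
    (tau * (df c - s)) * ((dg c - dg x) * (y - x)) by ring.
  by rewrite ltW // mulr_gt0 // mulr_gt0 ?subr_gt0 // dg_mono.
have [c [_ cx Kc]] := mean_value yx (fun z _ => K_d z).
have -> : tau * (K y - K x) = (tau * (df c - s)) * ((dg x - dg c) * (x - y)).
  by rewrite -opprB Kc; ring.
by rewrite ltW // mulr_gt0 // mulr_gt0 ?subr_gt0 // dg_mono.
Qed.

(** Intermediate value theorem for the difference b - a along a segment of the
    plane. *)
Lemma disjoint_ranges_ordered (R : realType) (a da b db : R -> R) :
  (forall x : R, is_derive x 1 a (da x)) ->
  (forall x : R, is_derive x 1 b (db x)) ->
  range a `&` range b = set0 ->
  exists2 tau : R, tau = 1 \/ tau = -1 & forall x y, 0 < tau * (b y - a x).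
Proof.
move=> a_d b_d disj.
have a_neq_b x y : b y - a x != 0.
  rewrite subr_eq0; apply/eqP => byax.
  have : (range a `&` range b) (a x) by split; [exists x|exists y].
  by rewrite disj.
have no_sign_change x y x' y' : 0 < b y - a x -> b y' - a x' < 0 -> False.
  move=> pos neg.
  pose F (t : R) := b (t * (y' - y) + y) - a (t * (x' - x) + x).
  have line_d (z z' t : R) : is_derive t 1 (fun t => t * (z' - z) + z) (z' - z).
    by apply: is_derive_eq; rewrite /GRing.scale /=; ring.
  have F_d (t : R) : is_derive t 1 F (db (t * (y' - y) + y) * (y' - y)
      - da (t * (x' - x) + x) * (x' - x)).
    have ? : is_derive t 1 (b \o (fun t => t * (y' - y) + y)) _ :=
      is_derive1_comp (b_d _) (line_d y y' t).
    have ? : is_derive t 1 (a \o (fun t => t * (x' - x) + x)) _ :=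
      is_derive1_comp (a_d _) (line_d x x' t).
    exact: is_deriveB.
  have [||t _ /eqP] := @IVT R F 0 1 0 ler01; last by apply/negP/a_neq_b.
    exact: (is_derive_continuous_within (fun t _ => F_d t)).
  have -> : F 0 = b y - a x by rewrite /F !mul0r !add0r.
  have -> : F 1 = b y' - a x' by rewrite /F !mul1r !subrK.
  by rewrite ge_min le_max (ltW neg) (ltW pos) orbT.
have [pos|neg|/eqP] := ltgtP 0 (b 0 - a 0); last first.
- by rewrite eq_sym (negPf (a_neq_b _ _)).
- exists (-1) => [|x y]; first by right.
  rewrite mulN1r oppr_gt0 lt_neqAle a_neq_b leNgt; apply/negP => pos.
  exact: no_sign_change pos neg.
- exists 1 => [|x y]; first by left.
  rewrite mul1r lt_neqAle eq_sym a_neq_b leNgt; apply/negP.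
  exact: no_sign_change pos.
Qed.

(** The state i is extremal for u_1, in the direction set by the signs s1 of
    f1'' and tau of f2' - f1'. *)
Lemma no_T4_coupled_burgers (R : realType) (f1 f2 h g Q1 Q2 : R -> R)
    (X : 'I_4 -> 'M[R]_(3, 2)) :
  smooth f1 -> smooth f2 -> range f1^`() `&` range f2^`() = set0 ->
  (forall x : R, f1^`(2) x != 0) -> (forall x : R, f2^`(2) x != 0) ->
  smooth h -> smooth g -> strictly_convex h -> strictly_convex g ->
  (forall x : R, is_derive x 1 Q1 (h^`() x * f1^`() x)) ->
  (forall x : R, is_derive x 1 Q2 (g^`() x * f2^`() x)) ->
  T4_configuration X ->
  ~ forall i, Kset [set: R * R] (burgers_flux f1 f2)
    (fun U => h U.1 + g U.2) (fun U => Q1 U.1 + Q2 U.2) (X i).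
Proof.
move=> sf1 sf2 disj ddf1 ddf2 sh sg h_cvx g_cvx Q1_d Q2_d T4.
move=> /(T4_states T4)[U [l [U_inj _ l_gt0 sum0]]].
have smooth_d (k : R -> R) :
    smooth k -> forall x : R, is_derive x 1 k (k^`() x).
  by move=> sk x; apply: derivable_is_derive1; exact: (sk 0).
have smooth_dd (k : R -> R) :
    smooth k -> forall x : R, is_derive x 1 k^`() (k^`(2) x).
  by move=> sk x; apply: derivable_is_derive1; exact: (sk 1).
have dh_mono := strictly_convex_derive_lt h_cvx (smooth_d _ sh).
have dg_mono := strictly_convex_derive_lt g_cvx (smooth_d _ sg).
have df_mono (k : R -> R) : smooth k -> (forall x : R, k^`(2) x != 0) ->
    exists2 s : R, s = 1 \/ s = -1 &
      forall x y : R, x < y -> s * k^`() x < s * k^`() y.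
  move=> sk ddk.
  have [s sP s_mono] := derive_neq0_monotone (I := `]-oo, +oo[%R)
    (fun x _ => smooth_dd _ sk x) (fun x _ => ddk x).
  by exists s => // x y; apply: s_mono; rewrite in_itv.
have [s1 s1P df1_mono] := df_mono f1 sf1 ddf1.
have [s2 s2P df2_mono] := df_mono f2 sf2 ddf2.
have [tau tauP f12] :=
  disjoint_ranges_ordered (smooth_dd _ sf1) (smooth_dd _ sf2) disj.
have tau2 : tau * tau = 1 by case: tauP => ->; ring.
have gap1 :=
  chebyshev_gap (smooth_d _ sf1) (smooth_d _ sh) Q1_d df1_mono dh_mono.
have gap2 :=
  chebyshev_gap (smooth_d _ sf2) (smooth_d _ sg) Q2_d df2_mono dg_mono.
have [i _ i_min] := @arg_minP _ _ _ (ord0 : 'I_4) xpredT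
  (fun i => s1 * tau * (U i).1) isT.
have [uu u1 u2] := sum0 i.
set eta := fun U => h U.1 + g U.2 in u1 u2.
set q := fun U => Q1 U.1 + Q2 U.2 in u1 u2.
pose F := burgers_flux f1 f2.
(* Row 3 is reduced by g' times row 2, taken at U i. *)
pose D j := minor_1eta F eta q (U i) (U j)
  - g^`() (U i).2 * minor_uu F (U i) (U j).
pose T j := ((U j).1 - (U i).1) * (Q1 (U j).1 - Q1 (U i).1)
  - (f1 (U j).1 - f1 (U i).1) * (h (U j).1 - h (U i).1).
have D_ge j : s1 * T j <= s1 * D j.
  (* The chord slope s of f1 is a value of f1'. *)
  have [s [f1s sf2s]] : exists s : R,
      f1 (U j).1 - f1 (U i).1 = s * ((U j).1 - (U i).1) /\
      forall y, 0 < tau * (f2^`() y - s).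
    have [lt|gt|->] := ltgtP (U i).1 (U j).1.
    - have [c [_ _ fc]] := mean_value lt (fun z _ => smooth_d _ sf1 z).
      by exists (f1^`() c).
    - have [c [_ _ fc]] := mean_value gt (fun z _ => smooth_d _ sf1 z).
      by exists (f1^`() c); split => //; rewrite -opprB fc -mulrN opprB.
    - by exists (f1^`() 0); rewrite !subrr mulr0.
  have := transverse_gap (smooth_d _ sf2) (smooth_d _ sg) Q2_d sf2s dg_mono
    (U i).2 (U j).2.
  set B := (X in tau * X) => B_ge0.
  have -> : D j = T j + tau * tau * ((U j).1 - (U i).1) * B.
    rewrite tau2 mul1r /D /T /minor_1eta /minor_uu /F /burgers_flux /=.
    by rewrite /eta /q /B f1s; ring.
  rewrite -subr_ge0.
  have -> : s1 * (T j + tau * tau * ((U j).1 - (U i).1) * B) - s1 * T j =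
    (s1 * tau * (U j).1 - s1 * tau * (U i).1) * (tau * B) by ring.
  by rewrite mulr_ge0 // subr_ge0 i_min.
have T_ge0 j : 0 <= s1 * T j.
  rewrite /T; have [->|ij] := eqVneq (U i).1 (U j).1.
    by rewrite !subrr ?mul0r ?subrr mulr0.
  by rewrite ltW // gap1.
have sumD : \sum_j l i j * (s1 * D j) = 0.
  transitivity (s1 * (\sum_j l i j * minor_1eta F eta q (U i) (U j)
    - g^`() (U i).2 * \sum_j l i j * minor_uu F (U i) (U j))).
    rewrite mulrBr !mulr_sumr -sumrB.
    by apply: eq_bigr => j _; rewrite /D; ring.
  by rewrite u1 uu mulr0 subrr mulr0.
have U1_eq j : (U i).1 = (U j).1.
  apply/eqP; apply: contraT => ij.
  have /eqP := psumr_eq0P (F := fun k => l i k * (s1 * D k)) (P := xpredT)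
    (fun k _ => mulr_ge0 (ltW (l_gt0 i k)) (le_trans (T_ge0 k) (D_ge k)))
    sumD (i := j) isT.
  rewrite mulf_eq0 gt_eqF //= => /eqP Dj0.
  by have := D_ge j; rewrite Dj0 leNgt gap1.
have sum2 : \sum_j l i j * (s2 * minor_2eta F eta q (U i) (U j)) = 0.
  by under eq_bigr do rewrite mulrCA; rewrite -mulr_sumr u2 mulr0.
have [j ij] : exists j : 'I_4, i != j.
  by have [->|i0] := eqVneq i ord0; [exists ord_max|exists ord0].
have pos k : (U i).2 != (U k).2 ->
    0 < s2 * minor_2eta F eta q (U i) (U k).
  move=> ik; have := gap2 _ _ ik; congr (0 < s2 * _).
  by rewrite /minor_2eta /F /burgers_flux /eta /q /= -(U1_eq k); ring.
have : (U i).2 != (U j).2.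
  apply: contra ij => /eqP eq2; apply/eqP/U_inj.
  by rewrite (surjective_pairing (U i)) eq2 (U1_eq j) -surjective_pairing.
move=> /pos; apply/negP; rewrite -leNgt.
have ge0 k : 0 <= s2 * minor_2eta F eta q (U i) (U k).
  have [eq2|/pos/ltW //] := eqVneq (U i).2 (U k).2.
  by rewrite /minor_2eta /F /burgers_flux /= eq2 !subrr ?mul0r ?subrr mulr0.
have /eqP := psumr_eq0P (P := xpredT)
  (fun k _ => mulr_ge0 (ltW (l_gt0 i k)) (ge0 k)) sum2 (i := j) isT.
by rewrite mulf_eq0 gt_eqF //= => /eqP ->.
Qed.

Theorem theorem1p1 (R : realType) (V : set (R * R)) (f : R * R -> R * R)
    (eta q : R * R -> R) (hsys : listed_system V f eta q) :
  ~ (exists X : 'I_4 -> 'M[R]_(3, 2),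
       T4_configuration X /\ forall i : 'I_4, Kset V f eta q (X i)).
Proof.
case: hsys => [p A|P S|kappa gamma|f1 f2 h g Q1 Q2].
- by move=> ? ? ? ? ? [X [T4]]; exact: no_T4_p_system.
- by move=> ? ? ? ? ? [X [T4]]; exact: no_T4_isentropic_euler.
- by move=> ? ? [X [T4]]; exact: no_T4_ideal_gas.
- by move=> ? ? ? ? ? ? ? ? ? ? ? [X [T4]]; exact: no_T4_coupled_burgers.
Qed.
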